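(* Let $\mathcal{A}$ be a complex algebra and let $\mathcal{N}$ be a maximal nest (on a Hilbert space $\mathcal{H}$) which is ordered as $\mathbb{N}\cup\{\infty\}$. Let $\rho$ be a representation of $\mathcal{A}$ so that $\rho(\mathcal{A})$ is w*-dense in $\operatorname{Alg}\mathcal{N}$. Then the following are equivalent: (i) $\rho(\mathcal{A})$ contains non-zero finite rank operators. (ii) $\ker\rho$ fails to be a prime ideal.
   Context: A nest on $\mathcal{H}$ is a linearly ordered family of closed subspaces of $\mathcal{H}$ containing $0$ and $\mathcal{H}$ and closed under arbitrary intersections and closed spans; it is maximal if it is not properly contained in another nest. $\operatorname{Alg}\mathcal{N}$ is the algebra of all bounded operators on $\mathcal{H}$ leaving every element of $\mathcal{N}$ invariant. ''Ordered as $\mathbb{N}\cup\{\infty\}$'' means order isomorphic to $\mathbb{N}\cup\{\infty\}$ with its usual order. A representation of the complex algebra $\mathcal{A}$ is an algebra homomorphism $\rho:\mathcal{A}\to B(\mathcal{H})$. w* refers to the weak-* ($\sigma$-weak) topology of $B(\mathcal{H})$; that $\rho(\mathcal{A})$ is w*-dense in $\operatorname{Alg}\mathcal{N}$ includes $\rho(\mathcal{A})\subseteq\operatorname{Alg}\mathcal{N}$. Ideals of the complex algebra $\mathcal{A}$ are two-sided; a (proper) ideal $\mathcal{P}$ is prime if for two-sided ideals $\mathcal{J}_1,\mathcal{J}_2$ of $\mathcal{A}$, $\mathcal{J}_1\mathcal{J}_2\subseteq\mathcal{P}$ implies $\mathcal{J}_1\subseteq\mathcal{P}$ or $\mathcal{J}_2\subseteq\mathcal{P}$.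 *)

(* Defs.v *)
From HB Require Import structures.
From mathcomp Require Import all_boot all_order all_algebra.
From mathcomp Require Import sesquilinear complex.
From mathcomp Require Import all_classical all_reals all_analysis.

Set Implicit Arguments.
Unset Strict Implicit.
Unset Printing Implicit Defensive.

Import Order.TTheory GRing.Theory Num.Theory.
Import numFieldNormedType.Exports.
Local Open Scope classical_set_scope.
Local Open Scope ring_scope.

(** Subspaces *)

Section Subspaces.
Context {K : numFieldType} {H : normedModType K}.

Definition is_subspace {V : lmodType K} (M : set V) : Prop :=
  [/\ M 0, forall x y, M x -> M y -> M (x + y)
    & forall (c : K) x, M x -> M (c *: x)].

Definition lspan {V : lmodType K} (S : set V) : set V := smallest is_subspace S.

Definition closed_subspace (M : set H) : Prop := is_subspace M /\ closed M.

Definition closed_span (S : set H) : set H := closure (lspan S).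

End Subspaces.

(** Bounded operators *)

Section BoundedOperators.
Context {K : numFieldType} (H : normedModType K).

Definition is_bounded_op (T : H -> H) : Prop :=
  linear T /\ exists M : K, forall x, `|T x| <= M * `|x|.

Definition bounded_op_pred : {pred (H -> H)} := fun T => `[< is_bounded_op T >].

(* The carrier of B(H), a linear subspace of [H -> H]. *)
Record bounded_op := BoundedOp {
  bounded_op_fun :> H -> H;
  _ : bounded_op_fun \in bounded_op_pred }.

HB.instance Definition _ := [isSub for bounded_op_fun].
HB.instance Definition _ := [Choice of bounded_op by <:].

Fact bounded_op_submod_closed : submod_closed bounded_op_pred.
Proof.
split.
  apply/asboolP; split=> [a x y|]; first by rewrite /= scaler0 addr0.
  by exists 0 => x; rewrite normr0 mul0r.
move=> c S T /asboolP[linS [M MS]] /asboolP[linT [L LT]].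
apply/asboolP; split=> [a x y|].
  rewrite !fctE linS linT !scalerDr !scalerA [c * a]mulrC.
  by rewrite !addrA; congr (_ + _); rewrite addrAC.
exists (`|c| * M + L) => x; rewrite fctE mulrDl.
rewrite (le_trans (ler_normD _ _))// lerD// normrZ -mulrA.
by rewrite ler_wpM2l.
Qed.

HB.instance Definition _ := GRing.isSubmodClosed.Build K (H -> H)
  bounded_op_pred bounded_op_submod_closed.
HB.instance Definition _ :=
  [SubChoice_isSubLmodule of bounded_op by <:].

Definition finite_rank (T : H -> H) : Prop :=
  exists s : seq H, range T = lspan [set` s].

End BoundedOperators.

(** Nests *)

Section Nests.
Context {K : numFieldType} {H : normedModType K}.
Implicit Types N : set (set H).

Record is_nest N : Prop := IsNest {
  nest_closed : forall M, N M -> closed_subspace M;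
  nest_total : forall M L, N M -> N L -> M `<=` L \/ L `<=` M;
  nest0 : N [set 0];
  nestT : N setT;
  nest_bigcap : forall F, F `<=` N -> N (\bigcap_(M in F) M);
  nest_bigspan : forall F, F `<=` N -> N (closed_span (\bigcup_(M in F) M)) }.

Definition maximal_nest N : Prop :=
  is_nest N /\ forall N', is_nest N' -> N `<=` N' -> N' = N.

(* [None] stands for infinity. *)
Definition natinf_le (m n : option nat) : bool :=
  match m, n with
  | _, None => true
  | None, Some _ => false
  | Some i, Some j => (i <= j)%N
  end.

(* Injectivity of [e] follows from the equivalence. *)
Definition ordered_as_natinf N : Prop :=
  exists e : option nat -> set H,
    range e = N /\ forall m n, natinf_le m n <-> e m `<=` e n.

Definition nest_alg N : set (bounded_op H) :=
  [set T | forall M, N M -> forall x, M x -> M (T x)].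

End Nests.

(** The weak-* topology of B(H): the coarsest topology making continuous every
    functional T |-> \sum_n <T x_n, y_n> with (x_n), (y_n) square summable;
    these functionals are exactly the elements of the predual of B(H). *)

Section WeakStar.
Context {K : numClosedFieldType} {H : normedModType K}.

Definition square_summable (x : nat -> H) : Prop :=
  cvgn (series (fun n => `|x n| ^+ 2)).

Definition square_summable_pair : Type :=
  {xy : (nat -> H) * (nat -> H) |
    square_summable xy.1 /\ square_summable xy.2}.

Variable dot : {dot H for @Num.conj K}.

Definition wstar_eval (T : bounded_op H) : {ptws square_summable_pair -> K} :=
  fun p => limn (series (fun n => dot (T ((sval p).1 n)) ((sval p).2 n))).

Definition wstar : topologicalType := initial_topology wstar_eval.

Definition wstar_dense_in (S B : set (bounded_op H)) : Prop :=
  S `<=` B /\ B `<=` closure (S : set wstar).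

End WeakStar.

(** Complex algebras, not necessarily unital, given by an associative bilinear
    multiplication *)

Section Algebras.
Context {K : numFieldType} {A : lmodType K} (mul : {bilinear A -> A -> A}).
Implicit Types I J P : set A.

Definition is_ideal I : Prop :=
  is_subspace I /\
  forall a x, I x -> I (mul a x) /\ I (mul x a).

Definition ideal_mul I J : set A :=
  lspan [set mul x y | x in I & y in J].

Definition is_prime_ideal P : Prop :=
  [/\ is_ideal P, P <> setT
    & forall I J, is_ideal I -> is_ideal J ->
        ideal_mul I J `<=` P -> I `<=` P \/ J `<=` P].

Definition is_representation {H : normedModType K}
    (rho : {linear A -> bounded_op H}) : Prop :=
  forall a b, rho (mul a b) = rho a \o rho b :> (H -> H).

End Algebras.

Definition ker {K : numFieldType} {A B : lmodType K} (f : {linear A -> B}) :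
  set A := [set a | f a = 0].

(* Main.v *)
(** The elements of the nest are 0 = M_0 < M_1 < ... and H, where maximality
    forces M_(n+1) to be M_n plus a unit vector orthogonal to M_n, and the union
    of the M_n is dense. The rank one operator x |-> <x, v> u is in the nest
    algebra as soon as u is in M_n and v is orthogonal to M_n.

    If X B Y = 0 for all B in rho(A), then also for all B in the nest algebra;
    taking X u <> 0 with u in M_n and the above rank one operators for B shows
    that Y has range in M_n. So if ker rho is not prime, the two ideals that
    witness it provide a finite rank Y.

    Conversely the range of a finite rank operator in the nest algebra lies in
    some M_n. The elements of A that kill M_n and those with range in M_n are
    two ideals, the product of which is in ker rho; neither is contained in
    ker rho, because rho(A) contains nonzero operators killing M_n. *)

Require Import Defs.
From HB Require Import structures.
From mathcomp Require Import all_boot all_order all_algebra.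
From mathcomp Require Import sesquilinear complex.
From mathcomp Require Import all_classical all_reals all_analysis.

Import Order.TTheory GRing.Theory Num.Theory.
Import numFieldNormedType.Exports.
Local Open Scope classical_set_scope.
Local Open Scope ring_scope.

Set Implicit Arguments.
Unset Strict Implicit.
Unset Printing Implicit Defensive.

(** * Finitely generated subspaces and the adjunction of one vector *)

Section Subspaces.
Context {K : numFieldType} {V : lmodType K}.
Implicit Types (M L : set V) (u x y : V) (s : seq V).

Lemma subspaceN M x : is_subspace M -> M x -> M (- x).
Proof. by case=> _ _ MZ Mx; rewrite -scaleN1r; exact: MZ. Qed.

Lemma subspaceB M x y : is_subspace M -> M x -> M y -> M (x - y).
Proof. by move=> sM Mx My; case: (sM) => _ MD _; apply: MD => //; exact: subspaceN. Qed.

Lemma lspan_subspace (S : set V) : is_subspace (lspan S).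
Proof.
split=> [|x y Sx Sy|c x Sx] M sM; have [[M0 MD MZ] _] := sM => //.
- by apply: MD; [exact: (Sx M sM)|exact: (Sy M sM)].
- by apply: MZ; exact: (Sx M sM).
Qed.

Lemma sub_lspan (S : set V) : S `<=` lspan S.
Proof. exact: sub_gen_smallest. Qed.

Lemma lspan_min (S M : set V) : is_subspace M -> S `<=` M -> lspan S `<=` M.
Proof. exact: smallest_sub. Qed.

Lemma lspan_id M : is_subspace M -> lspan M = M.
Proof. exact: smallest_id. Qed.

Lemma subspace0 : is_subspace ([set 0] : set V).
Proof. by split=> [|x y -> ->|c x ->] //=; rewrite ?addr0 ?scaler0. Qed.

Definition adjoin M u : set V := [set x | exists c, M (x - c *: u)].

Lemma adjoin_subspace M u : is_subspace M -> is_subspace (adjoin M u).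
Proof.
move=> [M0 MD MZ]; split=> [|x y [c Mx] [d My]|a x [c Mx]].
- by exists 0; rewrite scale0r subr0.
- by exists (c + d); rewrite scalerDl opprD addrACA; exact: MD.
- by exists (a * c); rewrite -scalerA -scalerBr; exact: MZ.
Qed.

Lemma sub_adjoin M u : M `<=` adjoin M u.
Proof. by move=> x Mx; exists 0; rewrite scale0r subr0. Qed.

Lemma mem_adjoin M u : is_subspace M -> adjoin M u u.
Proof. by case=> M0 _ _; exists 1; rewrite scale1r subrr. Qed.

Lemma adjoin_min M L u : is_subspace L -> M `<=` L -> L u -> adjoin M u `<=` L.
Proof.
move=> [_ LD LZ] ML Lu x [c /ML Lx]; rewrite -(subrK (c *: u) x).
by apply: LD => //; exact: LZ.
Qed.

Lemma lspan_nil : lspan [set` [::]] = [set 0] :> set V.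
Proof.
rewrite eqEsubset; split; first by apply: lspan_min; [exact: subspace0|].
by move=> _ ->; case: (lspan_subspace [set` [::] : seq V]).
Qed.

Lemma lspan_cons u s : lspan [set` u :: s] = adjoin (lspan [set` s]) u.
Proof.
have sS := lspan_subspace [set` s].
rewrite eqEsubset; split.
  apply: lspan_min; first exact: adjoin_subspace.
  move=> x /=; rewrite inE => /orP[/eqP ->|xs]; first exact: mem_adjoin.
  by apply: sub_adjoin; apply: sub_lspan.
apply: adjoin_min; first exact: lspan_subspace.
  apply: lspan_min; first exact: lspan_subspace.
  by move=> x xs; apply: sub_lspan; rewrite /= inE xs orbT.
by apply: sub_lspan; rewrite /= mem_head.
Qed.

(** By induction on the generators: if [L] is not inside the span of [s], its intersection with that
    span has codimension one in [L], so generators of the intersection together with one vector of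
    [L] outside it generate [L]. *)
Lemma subspace_of_span s L :
  is_subspace L -> L `<=` lspan [set` s] -> exists s', L = lspan [set` s'].
Proof.
elim: s L => [|u s IHs] L sL.
  rewrite lspan_nil => L0; exists [::]; rewrite lspan_nil.
  by apply/seteqP; split=> // _ ->; case: sL.
rewrite lspan_cons => Lus.
have [Ls|/existsNP[l /not_implyP[Ll Nl]]] := pselect (L `<=` lspan [set` s]).
  exact: IHs.
have sS := lspan_subspace [set` s].
have [L0 LD LZ] := sL; have [S0 SD SZ] := sS.
have [||s' Es'] := IHs (L `&` lspan [set` s]); last 1 first.
- exists (l :: s'); rewrite lspan_cons -Es' eqEsubset; split; last first.
    by apply: adjoin_min => // x [].
  move=> x Lx; have [c xc] := Lus x Lx; have [d ld] := Lus l Ll.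
  have d0 : d != 0.
    by apply: contra_notN Nl => /eqP d0; move: ld; rewrite d0 scale0r subr0.
  (* The [u]-coefficients of [x] and [l] modulo the span of [s] are [c] and [d], so this multiple of
     [l] cancels the [u]-component of [x]. *)
  exists (c / d); split.
    by apply: (subspaceB sL) => //; apply: LZ.
  have -> : x - (c / d) *: l = (x - c *: u) - (c / d) *: (l - d *: u).
    by rewrite scalerBr scalerA divfK// opprB addrA subrK.
  by apply: (subspaceB sS) => //; apply: SZ.
- split=> [|x y [Lx Sx] [Ly Sy]|c x [Lx Sx]]; split=> //;
    [exact: LD|exact: SD|exact: LZ|exact: SZ].
- by move=> x [].
Qed.

End Subspaces.

(** * Orthogonal projections and Riesz vectors, built one dimension at a time *)

Section InnerProduct.
Context (K : numClosedFieldType) (H : normedModType K) (dot : {dot H for @Num.conj K}).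
Hypothesis norm_dot : forall x : H, dot x x = `|x| ^+ 2.
Implicit Types (M L : set H) (u v x y : H).

Lemma dotC x y : dot x y = (dot y x)^*.
Proof. by rewrite hermC expr0 mul1r. Qed.

Lemma dot_eq0C x y : dot x y = 0 -> dot y x = 0.
Proof. by move=> xy0; rewrite dotC xy0 conjC0. Qed.

Lemma dotxx_eq0 x : dot x x = 0 -> x = 0.
Proof. by move=> /eqP; rewrite dnorm_eq0 => /eqP. Qed.

Lemma dotZl c x y : dot (c *: x) y = c * dot x y.
Proof. exact: linearZl_LR. Qed.

Lemma dotZr c x y : dot x (c *: y) = c^* * dot x y.
Proof. exact: linearZr_LR. Qed.

Lemma pythagoras x y : dot x y = 0 -> `|x + y| ^+ 2 = `|x| ^+ 2 + `|y| ^+ 2.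
Proof.
move=> xy0; rewrite -!norm_dot linearDl !linearDr/=.
by rewrite xy0 (dot_eq0C xy0) addr0 add0r.
Qed.

Lemma pythagoras_le x y : dot x y = 0 -> `|x| <= `|x + y|.
Proof.
move=> /pythagoras xy; rewrite -(@ler_pXn2r _ 2)// ?nnegrE// xy lerDl.
exact: exprn_ge0.
Qed.

Lemma unit_vector x : x != 0 -> dot (`|x|^-1 *: x) (`|x|^-1 *: x) = 1.
Proof.
move=> x0; rewrite norm_dot normrZ normrV ?unitfE ?normr_eq0// normr_id.
by rewrite mulVf ?normr_eq0// expr1n.
Qed.

(** Cauchy-Schwarz from Pythagoras: for the unit vector [e] along [y], the vector [dot x e *: e] is
    the projection of [x] on a line, hence no longer than [x]. *)
Lemma dot_le x y : `|dot x y| <= `|x| * `|y|.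
Proof.
have [->|y0] := eqVneq y 0; first by rewrite linear0r !normr0 mulr0.
set e := `|y|^-1 *: y; have ee : dot e e = 1 by exact: unit_vector.
have ye : y = `|y| *: e by rewrite scalerA divff ?normr_eq0// scale1r.
clearbody e.
have e1 : `|e| = 1.
  by apply/eqP; rewrite -(@eqrXn2 _ 2)// -norm_dot ee expr1n.
rewrite ye dotZr !normrM normrZ norm_conjC normr_id e1 mulr1 mulrC ler_wpM2r//.
have : `|dot x e *: e| <= `|dot x e *: e + (x - dot x e *: e)|.
  apply: pythagoras_le; rewrite dotZl linearBr/= dotZr ee mulr1 -dotC.
  by rewrite subrr mulr0.
by rewrite addrC subrK normrZ e1 mulr1.
Qed.

Definition orthogonal_to M v : Prop := forall x, M x -> dot x v = 0.

Definition has_projection M : Prop :=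
  forall x, exists2 p, M p & orthogonal_to M (x - p).

(** No continuity is asked of [f]: the property is meant for finite dimensional [M], where it is
    reached from 0 by [adjoin_riesz]. *)
Definition has_riesz M : Prop := forall f : {scalar H},
  exists2 w, M w & forall x, M x -> f x = dot x w.

(** By Pythagoras the projection of [x] is a nearest point of [M], so a limit point of [M] is at
    distance 0 from its projection. *)
Lemma projection_closed M : has_projection M -> is_subspace M -> closed M.
Proof.
move=> pM sM x clMx; have [p Mp xp] := pM x.
suff -> : x = p by [].
apply/eqP; rewrite -subr_eq0; apply: contraT; rewrite -normr_gt0 => xp0.
have [l [Ml /=]] := clMx _ (nbhsx_ballx x _ xp0).
rewrite -ball_normE/= => /le_lt_trans; move=> /(_ `|x - p|).
suff xpl : `|x - p| <= `|x - l| by rewrite ltxx => /(_ xpl).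
rewrite -(subrKA p x (- l)); apply: pythagoras_le.
by apply: dot_eq0C; apply: xp; exact: subspaceB.
Qed.

Section Adjoin.
Context (M : set H) (u : H).
Hypotheses (sM : is_subspace M) (Mu : orthogonal_to M u) (uu : dot u u = 1).

Lemma adjoin_projection : has_projection M -> has_projection (adjoin M u).
Proof.
move=> pM x; have [p Mp xp] := pM x.
exists (p + dot x u *: u); first by exists (dot x u); rewrite addrK.
move=> y [c My]; rewrite -(subrK (c *: u) y) linearDl/= opprD addrA linearBr/=.
rewrite xp// dotZr (Mu My) mulr0 subr0 add0r dotZl.
rewrite !linearBr/= dotZr uu mulr1 (dot_eq0C (Mu Mp)) mulr0 subr0 -dotC.
by rewrite subrr.
Qed.

Lemma adjoin_riesz : has_riesz M -> has_riesz (adjoin M u).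
Proof.
move=> rM f; have [w Mw fw] := rM f.
(* The conjugate compensates for the conjugate linearity of [dot] in its second argument. *)
exists (w + (f u)^* *: u); first by exists (f u)^*; rewrite addrK.
move=> y [c My]; rewrite -(subrK (c *: u) y); move: (y - _) My => z Mz.
rewrite linearD/= linearDl/= !linearDr/= (fw _ Mz) scalarZ !dotZl !dotZr (Mu Mz) uu.
rewrite conjCK mulr0 addr0 mulr1.
by rewrite (dot_eq0C (Mu Mw)) mulr0 add0r mulrC.
Qed.

End Adjoin.

Lemma subspace0_projection : has_projection [set 0].
Proof. by move=> x; exists 0 => // y ->; rewrite linear0l. Qed.

Lemma subspace0_riesz : has_riesz [set 0].
Proof. by move=> f; exists 0 => // y ->; rewrite linear0l linear0. Qed.

(** One Gram-Schmidt step: [u] is the normalised difference of [v] and its projection on [M]. The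
    inclusion keeps the new space inside every subspace that contains [M] and [v]. *)
Lemma adjoin_orthonormal M v : is_subspace M -> has_projection M -> ~ M v ->
  exists u, [/\ orthogonal_to M u, dot u u = 1 & adjoin M u `<=` adjoin M v].
Proof.
move=> sM pM Mv; have [p Mp vp] := pM v.
have vp0 : v - p != 0.
  by apply: contra_notN Mv; rewrite subr_eq0 => /eqP ->.
exists (`|v - p|^-1 *: (v - p)); split; last 1 first.
- apply: adjoin_min; [exact: adjoin_subspace|exact: sub_adjoin|].
  have [_ _ aZ] := adjoin_subspace v sM; apply: aZ.
  apply: (subspaceB (adjoin_subspace v sM)); first exact: mem_adjoin.
  exact: sub_adjoin.
- by move=> x Mx; rewrite dotZr vp// mulr0.
- exact: unit_vector.
Qed.

End InnerProduct.

(** * From a maximal nest to a flag with one dimensional steps *)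

Section Nests.
Context (K : numClosedFieldType) (H : normedModType K) (dot : {dot H for @Num.conj K}).
Hypothesis norm_dot : forall x : H, dot x x = `|x| ^+ 2.
Implicit Types (N : set (set H)) (L M S : set H).

Lemma sub_closed_span S : S `<=` closed_span S.
Proof. by move=> x Sx; apply: subset_closure; apply: sub_lspan. Qed.

Lemma closed_span_min S L : closed_subspace L -> S `<=` L -> closed_span S `<=` L.
Proof.
move=> [sL /closure_id cL] SL; rewrite cL; apply: closureS.
exact: lspan_min.
Qed.

(** For a family containing [L], the intersection (or closed span) of its members from [N] is again
    in [N], hence comparable with [L]; the intersection (or closed span) of the whole family is then
    one of these two spaces. *)
Lemma is_nest_insert N L : is_nest N -> closed_subspace L ->
  (forall M, N M -> M `<=` L \/ L `<=` M) -> is_nest ([set L] `|` N).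
Proof.
move=> nN cL cmp; have [Nc Nt N0 NT Ncap Nspan] := nN.
have GN F : F `&` N `<=` N by move=> M [].
have FN F M : F `<=` [set L] `|` N -> F M -> M = L \/ (F `&` N) M.
  by move=> FLN FM; case: (FLN M FM); [left|right].
split.
- by move=> M [->|/Nc].
- by move=> M M' [->|NM] [->|NM']; [left|case: (cmp M' NM'); [right|left]|
    exact: cmp|exact: Nt].
- by right.
- by right.
- move=> F FLN; have NP := Ncap _ (GN F).
  have [FL|NFL] := pselect (F L); last first.
    by right; apply: Ncap => M FM; case: (FLN M FM) => // ML; case: NFL; rewrite -ML.
  have -> : \bigcap_(M in F) M = L `&` \bigcap_(M in F `&` N) M.
    apply/seteqP; split=> [x Fx|x [Lx Gx] M /(FN _ _ FLN)[->|/Gx]//].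
    by split; [apply: Fx|move=> M [FM _]; apply: Fx].
  by case: (cmp _ NP) => PL; [right; rewrite setIidr|left; rewrite setIidl].
- move=> F FLN; have NP := Nspan _ (GN F); set P := closed_span _ in NP.
  have [FL|NFL] := pselect (F L); last first.
    by right; apply: Nspan => M FM; case: (FLN M FM) => // ML; case: NFL; rewrite -ML.
  have GP M : (F `&` N) M -> M `<=` P.
    by move=> GM x Mx; apply: sub_closed_span; exists M.
  have [PL|LP] := cmp _ NP; [left|right].
    rewrite /= eqEsubset; split.
      by apply: closed_span_min => // x [M /(FN _ _ FLN)[->//|/GP MP] /MP/PL].
    by move=> x Lx; apply: sub_closed_span; exists L.
  suff -> : closed_span (\bigcup_(M in F) M) = P by [].
  rewrite eqEsubset; split.
    apply: closed_span_min; first exact: Nc.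
    by move=> x [M /(FN _ _ FLN)[->/LP|/GP MP /MP]].
  apply: closureS; apply: lspan_min; first exact: lspan_subspace.
  by move=> x [M [FM _] Mx]; apply: sub_lspan; exists M.
Qed.

(** A one dimensional extension of [e (Some n)] inside [e (Some n.+1)] can be inserted into the
    nest, so by maximality it already belongs to it and must be [e (Some n.+1)]. Closedness of the
    extension uses the projection on [e (Some n)], so [step] assumes that projection and [proj]
    provides it by induction. *)
Lemma maximal_nest_flag N : maximal_nest N -> ordered_as_natinf N ->
  exists M : nat -> set H,
  [/\ M 0%N = [set 0],
      forall n, exists u,
        [/\ orthogonal_to dot (M n) u, dot u u = 1 & M n.+1 = adjoin (M n) u],
      closure (\bigcup_n M n) = setT
    & forall L, N L <-> L = setT \/ exists n, L = M n].
Proof.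
move=> [nN maxN] [e [eN ele]]; have [Nc Nt N0 NT Ncap Nspan] := nN.
have Ne m : N (e m) by rewrite -eN; exists m.
have eP L : N L -> exists m, L = e m by rewrite -eN => -[m _ <-]; exists m.
have sub0 m : e m 0 by case: (Nc _ (Ne m)) => -[].
have eT : e None = setT.
  have [m Em] := eP _ NT; apply/seteqP; split=> //; rewrite Em.
  by apply/ele; case: (m).
have ES n : e (Some n) `<=` e (Some n.+1) by apply/ele => /=.
have NES n : ~ e (Some n.+1) `<=` e (Some n) by move=> /ele /=; rewrite ltnn.
have step n : has_projection dot (e (Some n)) -> exists u,
    [/\ orthogonal_to dot (e (Some n)) u, dot u u = 1
      & e (Some n.+1) = adjoin (e (Some n)) u].
  move=> pM; have sM : is_subspace (e (Some n)) by case: (Nc _ (Ne (Some n))).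
  have sM1 : is_subspace (e (Some n.+1)) by case: (Nc _ (Ne (Some n.+1))).
  have /existsNP[v /not_implyP[M1v Mv]] := NES n.
  have [u [Mu uu uv]] := adjoin_orthonormal norm_dot sM pM Mv.
  exists u; split=> //; set L := adjoin _ u.
  have LM1 : L `<=` e (Some n.+1).
    by apply: (subset_trans uv); apply: adjoin_min.
  have NL : N L.
    rewrite -(maxN ([set L] `|` N)); [by left| |by move=> M NM; right].
    apply: is_nest_insert => //.
      split; first exact: adjoin_subspace.
      by apply: (projection_closed norm_dot);
        [exact: adjoin_projection|exact: adjoin_subspace].
    move=> M /eP[m ->].
    have [mn|nm] : natinf_le m (Some n) \/ natinf_le (Some n.+1) m.
    - by case: m => [m|]; [case: (leqP m n); [left|right]|right].
    - by left; apply: subset_trans (@sub_adjoin _ _ _ u); apply/ele.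
    - by right; apply: (subset_trans LM1); apply/ele.
  rewrite eqEsubset; split=> //.
  have [m Em] := eP _ NL; rewrite Em; apply/ele.
  case: m Em => // m Em /=; rewrite ltnNge; apply/negP => mn.
  (* Otherwise [u] would lie in [e (Some n)] and be orthogonal to itself. *)
  have /ele : natinf_le (Some m) (Some n) by [].
  rewrite -Em => /(_ u (mem_adjoin u sM)) /Mu.
  by rewrite uu => /eqP; rewrite oner_eq0.
have proj n : has_projection dot (e (Some n)).
  elim: n => [|n IHn].
    suff -> : e (Some 0%N) = [set 0] by exact: subspace0_projection.
    apply/seteqP; split=> [|_ ->//]; have [m ->] := eP _ N0.
    by apply/ele; case: m.
  have [u [Mu uu ->]] := step n IHn.
  by apply: adjoin_projection => //; case: (Nc _ (Ne (Some n))).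
exists (fun n => e (Some n)); split.
- apply/seteqP; split=> [|_ ->//]; have [m ->] := eP _ N0.
  by apply/ele; case: m.
- by move=> n; exact: step.
(* The closed span of the finite stages is a member [e m] containing all of them, so [m] is
   infinite. The union of the chain is already a subspace, so its closure is this closed span. *)
- have [|m Em] := eP (closed_span (\bigcup_(M in range (e \o Some)) M)).
    by apply: Nspan => _ [n _ <-]; exact: Ne.
  have PM n : e (Some n) `<=` e m.
    by rewrite -Em => x Mx; apply: sub_closed_span; exists (e (Some n)).
  have bigcupE : \bigcup_n e (Some n) = lspan (\bigcup_(M in range (e \o Some)) M).
    rewrite bigcup_image lspan_id//; split; first by exists 0%N.
      move=> x y [i _ Mx] [j _ My]; exists (maxn i j) => //.
      have [_ MD _] := (Nc _ (Ne (Some (maxn i j)))).1.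
      apply: MD.
        suff /ele : natinf_le (Some i) (Some (maxn i j)) by exact.
        exact: leq_maxl.
      suff /ele : natinf_le (Some j) (Some (maxn i j)) by exact.
      exact: leq_maxr.
    move=> c x [i _ Mx]; exists i => //.
    by have [_ _ MZ] := (Nc _ (Ne (Some i))).1; exact: MZ.
  move: Em; rewrite /closed_span -bigcupE => -> /=; rewrite -eT.
  case: m PM => // m /(_ m.+1) /NES [].
- move=> L; split=> [/eP[[n|] ->]|[->|[n ->]]]; [|by left|by []|exact: Ne].
  by right; exists n.
Qed.

End Nests.

(** * Linearity and continuity of bounded operators *)

Section BoundedOperators.
Context (K : numFieldType) (H : normedModType K).
Implicit Types (S T : bounded_op H) (x y : H).

Lemma bounded_op_linear T : linear T.
Proof. by have /asboolP[] : (T : H -> H) \in @bounded_op_pred _ H := valP T. Qed.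

HB.instance Definition _ T :=
  GRing.isLinear.Build K H H *:%R (bounded_op_fun T) (bounded_op_linear T).

Lemma bounded_opD S T x : (S + T) x = S x + T x.
Proof. by []. Qed.

Lemma bounded_opZ c T x : (c *: T) x = c *: T x.
Proof. by []. Qed.

Lemma bounded_op_eq0 T : (forall x, T x = 0) -> T = 0.
Proof. by move=> T0; apply/val_inj/funext => x; exact: T0. Qed.

Lemma range_subspace T : is_subspace (range T).
Proof.
split=> [|_ _ [x _ <-] [y _ <-]|c _ [x _ <-]].
- by exists 0 => //; exact: linear0.
- by exists (x + y) => //; exact: linearD.
- by exists (c *: x) => //; exact: linearZ.
Qed.

Lemma bounded_op_continuous T : continuous T.
Proof.
have /asboolP[_ [B TB]] : (T : H -> H) \in @bounded_op_pred _ H := valP T.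
apply/linear_bounded_continuous/linear_boundedP; near=> r => x.
have [->|x0] := eqVneq x 0; first by rewrite linear0 !normr0 mulr0.
have xp : 0 < `|x| by rewrite normr_gt0.
(* The bound [B] is a priori any scalar; a nonzero [x] forces it to be real and nonnegative. *)
have B0 : 0 <= B.
  by rewrite -(pmulr_lge0 _ xp); apply: le_trans (TB x).
apply: le_trans (TB x) _; rewrite ler_wpM2r//.
suff : `|B| <= r by rewrite ger0_norm.
by near: r; apply: nbhs_pinfty_ge; exact: normr_real.
Unshelve. all: by end_near. Qed.

Lemma bounded_op_closure T (S L : set H) : closed L ->
  (forall x, S x -> L (T x)) -> forall x, closure S x -> L (T x).
Proof.
move=> cL TSL; have /closure_id cTL : closed (T @^-1` L).
  exact: (continuous_closedP _).1 (@bounded_op_continuous T) _ cL.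
by move=> x Sx; rewrite -[L _]/((T @^-1` L) x) cTL; apply: closureS Sx.
Qed.

End BoundedOperators.

(** * Rank one operators and w*-continuity of matrix coefficients *)

Section WeakStar.
Context (K : numClosedFieldType) (H : normedModType K) (dot : {dot H for @Num.conj K}).
Hypothesis norm_dot : forall x : H, dot x x = `|x| ^+ 2.

Lemma rank_one_bounded u v : is_bounded_op (fun x : H => dot x v *: u).
Proof.
split=> [c x y|].
  by rewrite linearPl/= scalerDl scalerA.
exists (`|v| * `|u|) => x; rewrite normrZ [leRHS]mulrAC ler_wpM2r//.
by rewrite [leRHS]mulrC; exact: dot_le.
Qed.

Definition rank_one u v : bounded_op H :=
  BoundedOp (asboolT (rank_one_bounded u v)).

Lemma series_cvg2 (V : normedModType K) (f : nat -> V) :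
  (forall n, f n.+2 = 0) -> series f @ \oo --> f 0%N + f 1%N.
Proof.
move=> f0; apply: cvg_near_cst; exists 2%N => // -[//|[//|n]] _.
rewrite seriesEnat/= big_mkord 2!big_ord_recl big1 ?addr0// => i _.
exact: f0.
Qed.

(** Padding by zeros turns the sum of two matrix coefficients into one of the functionals that
    define the w* topology. *)
Definition two_terms (x0 x1 : H) (n : nat) : H :=
  match n with 0%N => x0 | 1%N => x1 | _ => 0 end.

Lemma two_terms_summable x0 x1 : square_summable (two_terms x0 x1).
Proof.
apply/cvg_ex; eexists; apply: series_cvg2 => n /=.
by rewrite normr0 expr0n.
Qed.

Definition two_terms_pair (x0 x1 y0 y1 : H) : @square_summable_pair _ H :=
  exist _ (two_terms x0 x1, two_terms y0 y1)
    (conj (@two_terms_summable x0 x1) (@two_terms_summable y0 y1)).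

Lemma wstar_eval_two_terms x0 x1 y0 y1 (T : bounded_op H) :
  wstar_eval dot T (two_terms_pair x0 x1 y0 y1) =
  dot (T x0) y0 + dot (T x1) y1.
Proof.
apply: cvg_lim; first exact: norm_hausdorff.
by apply: (@series_cvg2 K^o) => n /=; rewrite linear0r.
Qed.

(** The difference of the two coefficients is a w*-continuous functional of [T], so its zero set is
    w*-closed. This is the only form in which density is used below: an identity to be extended from
    [rho] to the nest algebra is first written as an equality of two coefficients. *)
Lemma wstar_dense_eq (S B : set (bounded_op H)) x0 y0 x1 y1 :
  wstar_dense_in dot S B ->
  (forall T, S T -> dot (T x0) y0 = dot (T x1) y1) ->
  forall T, B T -> dot (T x0) y0 = dot (T x1) y1.
Proof.
move=> [_ BS] SE T /BS clT; pose p := two_terms_pair x0 x1 y0 (- y1).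
pose ev (T : wstar dot) : K := wstar_eval dot T p.
have ev_cont : continuous ev.
  move=> U; apply: (@continuous_comp (wstar dot)
    {ptws @square_summable_pair _ H -> K} K (wstar_eval dot) (proj p)).
    exact: initial_continuous.
  exact: (@proj_continuous {classic @square_summable_pair K H} (fun=> K) p).
have /closure_id cl0 : closed (ev @^-1` [set 0]).
  apply: (continuous_closedP _).1 ev_cont _ _.
  exact/accessible_closed_set1/hausdorff_accessible/norm_hausdorff.
suff : (ev @^-1` [set 0]) T.
  rewrite /preimage/= /ev wstar_eval_two_terms linearNr/= => /eqP.
  by rewrite subr_eq0 => /eqP.
rewrite cl0; apply: closureS clT => U SU.
by rewrite /preimage/= /ev wstar_eval_two_terms linearNr/= SE// subrr.
Qed.

End WeakStar.

(** * Ideals attached to an invariant subspace *)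

Section Ideals.
Context (K : numFieldType) (A : lmodType K) (mul : {bilinear A -> A -> A}).
Context (H : normedModType K) (rho : {linear A -> bounded_op H}).
Hypothesis rhoM : is_representation mul rho.
Implicit Types (L : set H).

Lemma rho_mul a b x : rho (mul a b) x = rho a (rho b x).
Proof. by rewrite [LHS](congr1 (fun f => f x) (rhoM a b)). Qed.

Definition annihilator L : set A := [set a | forall x, L x -> rho a x = 0].

Definition into L : set A := [set a | forall x, L (rho a x)].

Lemma annihilator_ideal L : (forall a x, L x -> L (rho a x)) ->
  is_ideal mul (annihilator L).
Proof.
move=> rhoL; split; [split=> [x _|a b aL bL x Lx|c a aL x Lx]|move=> a b bL].
- by rewrite linear0.
- by rewrite linearD bounded_opD aL// bL// addr0.
- by rewrite linearZ bounded_opZ aL// scaler0.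
- split=> x Lx; rewrite rho_mul; first by rewrite bL// linear0.
  by rewrite bL//; exact: rhoL.
Qed.

Lemma into_ideal L : is_subspace L -> (forall a x, L x -> L (rho a x)) ->
  is_ideal mul (into L).
Proof.
move=> [L0 LD LZ] rhoL.
split; [split=> [x|a b aL bL x|c a aL x]|move=> a b bL].
- by rewrite linear0.
- by rewrite linearD; rewrite bounded_opD; exact: LD.
- by rewrite linearZ; rewrite bounded_opZ; exact: LZ.
- by split=> x; rewrite rho_mul; [exact: rhoL|exact: bL].
Qed.

Lemma ker_annihilator : ker rho = annihilator setT.
Proof.
apply/seteqP; split=> [a ra0 x _|a aT]; first by rewrite (ra0 : rho a = 0).
by apply: bounded_op_eq0 => x; exact: aT.
Qed.

Lemma ker_ideal : is_ideal mul (ker rho).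
Proof. by rewrite ker_annihilator; exact: annihilator_ideal. Qed.

Lemma annihilator_into_mul L : ideal_mul mul (annihilator L) (into L) `<=` ker rho.
Proof.
apply: lspan_min; first by case: ker_ideal.
move=> _ [a aL [b bL <-]]; apply: bounded_op_eq0 => x.
by rewrite rho_mul aL//; exact: bL.
Qed.

End Ideals.

(** * Operators and a flag of finite dimensional spaces with dense union *)

Section Flag.
Context (K : numClosedFieldType) (H : normedModType K) (dot : {dot H for @Num.conj K}).
Hypothesis norm_dot : forall x : H, dot x x = `|x| ^+ 2.
Context (M : nat -> set H).
Hypothesis M0 : M 0%N = [set 0].
Hypothesis MS : forall n, exists u,
  [/\ orthogonal_to dot (M n) u, dot u u = 1 & M n.+1 = adjoin (M n) u].
Hypothesis M_dense : closure (\bigcup_n M n) = setT.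
Implicit Types (T : bounded_op H).

Lemma flag_subspace n : is_subspace (M n).
Proof.
elim: n => [|n IHn]; first by rewrite M0; exact: subspace0.
by have [u [_ _ ->]] := MS n; exact: adjoin_subspace.
Qed.

Lemma flag_projection n : has_projection dot (M n).
Proof.
elim: n => [|n IHn]; first by rewrite M0; exact: subspace0_projection.
by have [u [Mu uu ->]] := MS n; apply: adjoin_projection.
Qed.

Lemma flag_riesz n : has_riesz dot (M n).
Proof.
elim: n => [|n IHn]; first by rewrite M0; exact: subspace0_riesz.
have [u [Mu uu ->]] := MS n; apply: adjoin_riesz => //; exact: flag_subspace.
Qed.

Lemma flag_closed n : closed (M n).
Proof.
by apply: (projection_closed norm_dot); [exact: flag_projection|exact: flag_subspace].
Qed.

Lemma flag_sub m n : (m <= n)%N -> M m `<=` M n.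
Proof.
elim: n => [|n IHn]; first by rewrite leqn0 => /eqP ->.
rewrite leq_eqVlt => /orP[/eqP -> //|/IHn mn].
have [u [_ _ ->]] := MS n; apply: subset_trans mn _; exact: sub_adjoin.
Qed.

Lemma flag_span n : exists s : seq H, M n = lspan [set` s].
Proof.
elim: n => [|n [s Es]]; first by exists [::]; rewrite M0 lspan_nil.
by have [u [_ _ ->]] := MS n; exists (u :: s); rewrite lspan_cons Es.
Qed.

Lemma bigcup_flag_subspace : is_subspace (\bigcup_n M n).
Proof.
split=> [|x y [i _ Mx] [j _ My]|c x [i _ Mx]].
- by exists 0%N => //; rewrite M0.
- exists (maxn i j) => //; have [_ MD _] := flag_subspace (maxn i j).
  by apply: MD; [apply: flag_sub Mx; exact: leq_maxl
                |apply: flag_sub My; exact: leq_maxr].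
- by exists i => //; have [_ _ MZ] := flag_subspace i; exact: MZ.
Qed.

Lemma flag_dense_image T L : closed L ->
  (forall n x, M n x -> L (T x)) -> forall x, L (T x).
Proof.
move=> cL TL x; apply: (@bounded_op_closure _ _ T (\bigcup_n M n)) => //.
  by move=> y [n _]; exact: TL.
by rewrite M_dense.
Qed.

Lemma flag_neq0 T : T <> 0 -> exists n x, M n x /\ T x <> 0.
Proof.
move=> T0; apply: contrapT => NT; apply/T0/bounded_op_eq0.
apply: (@flag_dense_image T [set 0]).
  exact/accessible_closed_set1/hausdorff_accessible/norm_hausdorff.
move=> n x Mx /=; apply: contrapT => Tx; apply: NT.
by exists n, x.
Qed.

(** A substitute for the adjoint: [w] plays the role of the projection on [M n] of the adjoint of
    [T] applied to [z], and comes from the Riesz property of [M n]. *)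
Lemma flag_adjoint T z n : exists2 w, M n w & forall x, M n x -> dot (T x) z = dot x w.
Proof.
pose f x := dot (T x) z.
have f_scalar : scalar f.
  by move=> c x y; rewrite /f linearP linearPl.
pose F : {scalar H} := HB.pack f (GRing.isLinear.Build _ _ _ _ f f_scalar).
exact: (flag_riesz n F).
Qed.

Lemma finite_rank_in_flag T n : (forall x, M n (T x)) -> finite_rank T.
Proof.
move=> TM; have [s Es] := flag_span n.
apply: (@subspace_of_span _ _ s); first exact: range_subspace.
by rewrite -Es => _ [x _ <-].
Qed.

(* The image of the union of the flag is a subspace of a finitely generated
   one, hence finitely generated, hence inside a single [M n]; as [M n] is
   closed it then contains the whole range. *)
Lemma finite_rank_flag T : (forall n x, M n x -> M n (T x)) ->
  finite_rank T -> exists n, forall x, M n (T x).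
Proof.
move=> TM [s Ts]; set D := [set T x | x in \bigcup_n M n].
have [U0 UD UZ] := bigcup_flag_subspace.
have [||s' Es'] := @subspace_of_span _ _ s D.
- split=> [|_ _ [x Ux <-] [y Uy <-]|c _ [x Ux <-]].
  + by exists 0 => //; exact: linear0.
  + by exists (x + y); [exact: UD|exact: linearD].
  + by exists (c *: x); [exact: UZ|exact: linearZ].
- by rewrite -Ts => _ [x _ <-]; exists x.
have sM : forall y, y \in s' -> exists n, M n y.
  move=> y ys; have : D y by rewrite Es'; apply: sub_lspan.
  by move=> [x [n _ Mx] <-]; exists n; exact: TM.
have [n sn] : exists n, forall y, y \in s' -> M n y.
  elim: s' sM {Es'} => [_|y s' IHs sM]; first by exists 0%N.
  have [|i si] := IHs; first by move=> z zs; apply: sM; rewrite inE zs orbT.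
  have [j yj] := sM y (mem_head _ _).
  exists (maxn i j) => z; rewrite inE => /orP[/eqP ->|/si].
    by apply: flag_sub yj; exact: leq_maxr.
  by apply: flag_sub; exact: leq_maxl.
exists n; apply: flag_dense_image; first exact: flag_closed.
move=> m x Mx; have : D (T x) by exists x => //; exists m.
by rewrite Es'; apply: lspan_min; [exact: flag_subspace|exact: sn].
Qed.

(** * Consequences of w*-density in the nest algebra *)

Section Representation.
Context (N : set (set H)) (NM : forall L, N L -> L = setT \/ exists n, L = M n).
Hypothesis MN : forall n, N (M n).
Context (A : lmodType K) (mul : {bilinear A -> A -> A}).
Context (rho : {linear A -> bounded_op H}) (rhoM : is_representation mul rho).
Hypothesis rho_dense : wstar_dense_in dot (range rho) (nest_alg N).

(** A member [M m] with [n <= m] contains [u], hence the range; one with [m < n] lies in [M n] and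
    is killed. *)
Lemma rank_one_nest_alg n u v : M n u -> orthogonal_to dot (M n) v ->
  nest_alg N (rank_one norm_dot u v).
Proof.
move=> Mu Mv L /NM[-> //|[m ->]] x Mx /=.
have [M0m _ MZ] := flag_subspace m.
have [nm|mn] := leqP n m; first by apply: MZ; exact: flag_sub Mu.
by rewrite Mv ?scale0r//; apply: flag_sub Mx; exact: ltnW.
Qed.

Lemma rho_flag a n x : M n x -> M n (rho a x).
Proof.
by have [rhoN _] := rho_dense; move=> Mx; apply: (rhoN (rho a)) => //; exists a.
Qed.

Lemma rho_neq0 : exists a, rho a <> 0.
Proof.
apply: contrapT => rho0; have [u [_ uu M1]] := MS 0; have [v [Mv vv _]] := MS 1.
have Mu : M 1%N u by rewrite M1; exact/mem_adjoin/flag_subspace.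
(* The coefficient at zero vectors is 0, so [wstar_dense_eq] here extends the vanishing of a single
   coefficient. *)
suff : dot (rank_one norm_dot u v v) u = dot (rank_one norm_dot u v 0) 0.
  by rewrite /= vv scale1r uu linear0r => /eqP; rewrite oner_eq0.
apply: (wstar_dense_eq rho_dense); last exact: rank_one_nest_alg Mu Mv.
move=> _ [a _ <-]; suff -> : rho a = 0 by rewrite /= linear0l linear0r.
by apply: contrapT => ra0; apply: rho0; exists a.
Qed.

(* If [rho a <> 0] kills [M k] but no [rho (a s - c a)] that kills [M k.+1]
   is nonzero, then [rho a \o rho s] is the multiple of [rho a] by the
   diagonal entry of [rho s] at [e]; by density this would hold for every
   operator of the nest algebra, and it fails for a suitable rank one. *)
Lemma rho_kills_flag k : exists a, rho a <> 0 /\ forall x, M k x -> rho a x = 0.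
Proof.
elim: k => [|k [a [ra0 raM]]].
  have [a ra0] := rho_neq0; exists a; split=> // x.
  by rewrite M0 => ->; exact: linear0.
apply: contrapT => Nb; have [e [Me ee Mk1]] := MS k.
have Mk1e : M k.+1 e by rewrite Mk1; exact/mem_adjoin/flag_subspace.
have ras s x : rho a (rho s x) = dot (rho s e) e *: rho a x.
  set c := dot _ e; pose b := mul a s - c *: a.
  have rhob y : rho b y = rho a (rho s y) - c *: rho a y.
    by rewrite -(rho_mul rhoM) /b linearB linearZ.
  suff : rho b = 0.
    by move/(congr1 (fun T : bounded_op H => T x)); rewrite rhob => /subr0_eq.
  apply: contrapT => rb0; apply: Nb; exists b; split=> // y.
  (* Both terms of [rho b] vanish on [M k]. They cancel at [e], because [rho s e] is [c *: e] modulo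
     [M k], which [rho a] kills. *)
  have := rho_flag s Mk1e; rewrite Mk1 => -[d Mse] [t Mty].
  have dE : d = c.
    have := Me _ Mse; rewrite linearBl/= dotZl ee mulr1 => /subr0_eq.
    exact: esym.
  have rase : rho a (rho s e) = c *: rho a e.
    by have := raM _ Mse; rewrite linearB linearZ/= dE => /subr0_eq.
  rewrite rhob -(subrK (t *: e) y); move: (y - _) Mty => z Mz.
  have sMz := rho_flag s Mz; rewrite !linearD !linearZ/= rase (raM _ Mz) (raM _ sMz).
  by rewrite oppr0 scaler0 !add0r !scalerN !scalerA mulrC subrr.
have [n0 [u [Mu0 rau]]] := flag_neq0 ra0.
pose n := maxn n0 k.+1.
have Mu : M n u by apply: flag_sub Mu0; exact: leq_maxl.
have Mne : M n e by apply: flag_sub Mk1e; exact: leq_maxr.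
have [v [Mv vv Mn1]] := MS n.
have Mn1v : M n.+1 v by rewrite Mn1; exact/mem_adjoin/flag_subspace.
(* With [w] and [z], the identity [ras] at [v], paired with [rho a u], becomes an equality of two
   coefficients of [rho s]. The rank one operator sends [v] to [u] and [e] to 0, so for it the left
   side is the squared norm of [rho a u] and the right side is 0. *)
have [w _ wE] := flag_adjoint (rho a) (rho a u) n.+1.
pose z := (dot (rho a v) (rho a u))^* *: e.
have : dot (rank_one norm_dot u v v) w = dot (rank_one norm_dot u v e) z.
  apply: (wstar_dense_eq rho_dense); last exact: rank_one_nest_alg Mu Mv.
  move=> _ [s _ <-]; rewrite -wE; last exact: rho_flag.
  by rewrite ras dotZl dotZr conjCK mulrC.
rewrite /= vv scale1r (Mv _ Mne) scale0r linear0l -wE.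
  by move=> /dotxx_eq0/rau.
by apply: flag_sub Mu; exact: leqnSn.
Qed.

Lemma range_in_flag (X Y : bounded_op H) : X <> 0 -> (forall n x, M n x -> M n (Y x)) ->
  (forall b x, X (rho b (Y x)) = 0) -> exists n, forall x, M n (Y x).
Proof.
move=> X0 YM XrY; have [n [u [Mu Xu0]]] := flag_neq0 X0.
exists n; apply: flag_dense_image; first exact: flag_closed.
move=> m x Mx; have [p Mp Yxp] := flag_projection n (Y x).
(* The residual [Y x - p] is orthogonal to [p], so this product is its squared norm. *)
suff Yxp0 : dot (Y x) (Y x - p) = 0.
  have : dot (Y x - p) (Y x - p) = 0 by rewrite linearBl/= Yxp0 Yxp// subrr.
  by move=> /dotxx_eq0/subr0_eq ->.
set v := Y x - p in Yxp *.
pose k := maxn m n.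
have Mk_u : M k u by apply: flag_sub Mu; exact: leq_maxr.
have Mk_Yx : M k (Y x) by apply: (flag_sub (leq_maxl m n)); exact: YM.
(* On [M k], pairing with [w] is applying [X] and pairing with [X u]. The coefficient at [Y x] and
   [w] thus vanishes on [rho], while for the rank one operator it is [dot (Y x) v] times the squared
   norm of [X u]. *)
have [w _ wE] := flag_adjoint X (X u) k.
suff : dot (rank_one norm_dot u v (Y x)) w = dot (rank_one norm_dot u v 0) 0.
  rewrite linear0r/= dotZl -wE// => /eqP; rewrite mulf_eq0 => /orP[/eqP//|/eqP].
  by move=> /dotxx_eq0.
apply: (wstar_dense_eq rho_dense); last exact: rank_one_nest_alg Mu Yxp.
by move=> _ [b _ <-]; rewrite linear0r -wE ?XrY ?linear0l//; exact: rho_flag.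
Qed.

End Representation.
End Flag.

(** * The equivalence *)

Unset Implicit Arguments.

Theorem theorem3p3 (R : realType)
  (H : completeNormedModType R[i]) (dot : {dot H for @Num.conj R[i]})
  (norm_dot : forall x : H, dot x x = `|x| ^+ 2)
  (A : lmodType R[i]) (mul : {bilinear A -> A -> A})
  (mulA : associative mul)
  (N : set (set H)) (maxN : maximal_nest N) (ordN : ordered_as_natinf N)
  (rho : {linear A -> bounded_op H}) (rhoM : is_representation mul rho)
  (rho_dense : wstar_dense_in dot (range rho) (nest_alg N)) :
  (exists T, [/\ range rho T, T <> 0 & finite_rank T])
  <-> ~ is_prime_ideal mul (ker rho).
Proof.
have [M [M0 MS M_dense NM]] := maximal_nest_flag norm_dot maxN ordN.
have NM1 L : N L -> L = setT \/ exists n, L = M n by move/NM.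
have MN n : N (M n) by apply/NM; right; exists n.
have rhoMn n a x : M n x -> M n (rho a x) by exact: (rho_flag MN rho_dense).
split=> [[_ [[a _ <-] ra0 ra_fin]] [_ _ primeP]|Nprime].
  have [n nT] : exists n, forall x, M n (rho a x).
    by apply: (finite_rank_flag norm_dot M0 MS M_dense) ra_fin => n x; exact: rhoMn.
  have [b [rb0 rbM]] := rho_kills_flag norm_dot M0 MS M_dense NM1 MN rhoM rho_dense n.
  have [] := primeP _ _ (annihilator_ideal rhoM (rhoMn n))
    (into_ideal rhoM (flag_subspace M0 MS n) (rhoMn n))
    (annihilator_into_mul rhoM (L := M n)).
    by move=> /(_ b rbM).
  by move=> /(_ a nT).
(* By contraposition: the kernel is a proper ideal, and two ideals not inside it with product inside
   it would yield a finite rank operator. *)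
apply: contrapT => Nfin; apply: Nprime; split; first exact: ker_ideal.
  have [a ra0] := rho_neq0 norm_dot M0 MS NM1 rho_dense.
  by move=> kerT; apply: ra0; have : ker rho a by rewrite kerT.
move=> I J idI idJ IJ; apply: contrapT => /not_orP[].
move=> /existsNP[a /not_implyP[Ia ra0]] /existsNP[b /not_implyP[Jb rb0]].
apply: Nfin; exists (rho b); split=> //.
have [||n rbM] := range_in_flag norm_dot M0 MS M_dense NM1 MN rho_dense
  (X := rho a) (Y := rho b) ra0.
- by move=> n x; exact: rhoMn.
- move=> c x; have : ker rho (mul (mul a c) b).
    (* The middle factor [c] is absorbed by the ideal [I]. *)
    by apply: IJ; apply: sub_lspan; exists (mul a c); [exact: (idI.2 c a Ia).2|exists b].
  by move=> /= /(congr1 (fun T : bounded_op H => T x)); rewrite !(rho_mul rhoM).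
exact: finite_rank_in_flag M0 MS _ _ rbM.
Qed.
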